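(* There is a function $h:\sigma\mathbb Q\to\omega$ such that for every ladder system $\mathbf C$ and every $\omega$-colouring $\mathbf f$ of $\mathbf C$ there is a non-special subtree $T\subseteq\sigma\mathbb Q$ such that $h\upharpoonright T$ is a $\sigma\mathbb Q$-uniformization of $\mathbf f$ (with domain $T$).
   Context: $\sigma\mathbb Q$ is the set of all subsets of $\mathbb Q$ which are well ordered by the usual order of $\mathbb Q$ and bounded above in $\mathbb Q$, ordered by end-extension; it is a tree of height $\omega_1$. For a tree, $s\upharpoonright\xi$ is the predecessor of $s$ of height $\xi$. A subtree of a tree $U$ of height $\omega_1$ is a downward closed $S\subseteq U$ in which every node has extensions in $S$ of arbitrarily large countable height. A ladder system is $\mathbf C=(C_\alpha)_{\alpha\in\lim(\omega_1)}$ with $C_\alpha$ a cofinal subset of $\alpha$ of order type $\omega$; an $\omega$-colouring is $(f_\alpha)$ with $f_\alpha:C_\alpha\to\omega$. A map $\varphi$ on a subtree $S$ of $U$ is a $U$-uniformization of $\mathbf f$ if for every $s\in S$ of limit height $\alpha$ and all but finitely many $\xi\in C_\alpha$, $\varphi(s\upharpoonright\xi)=f_\alpha(\xi)$. A tree is special if it is a countable union of antichains. *)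

(* Defs.v *)
From HB Require Import structures.
From mathcomp Require Import all_boot all_order all_algebra.
From mathcomp Require Import boolp classical_sets functions cardinality wochoice.

Set Implicit Arguments.
Unset Strict Implicit.
Unset Printing Implicit Defensive.

Import Order.TTheory.
Local Open Scope classical_set_scope.
Local Open Scope order_scope.

(* The ordinal omega_1 is realized as the initial segment, in a fixed
   well-ordering of the continuum, of the points with countably many
   predecessors. The three lemmas [omega1_wf], [omega1_countable] and
   [omega1_uncountable] below characterize it up to isomorphism. *)
Definition wo_cont : rel (set nat) := sval (well_ordering_principle (set nat)).

Record omega1 : Type := Omega1 {
  omega1_val : set nat;
  omega1_valP : countable [set b | wo_cont b omega1_val] }.

HB.instance Definition _ := gen_eqMixin omega1.
HB.instance Definition _ := gen_choiceMixin omega1.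

Lemma omega1_val_inj : injective omega1_val.
Proof.
move=> [A pA] [B pB] /= E; subst B; congr Omega1; exact: Prop_irrelevance.
Qed.

Lemma wo_contP : well_order wo_cont.
Proof. exact: (svalP (well_ordering_principle (set nat))). Qed.

Lemma wo_cont_chain : wo_chain wo_cont predT.
Proof. by move=> A _; exact: wo_contP. Qed.

Definition omega1_le (a b : omega1) : bool := wo_cont (omega1_val a) (omega1_val b).

Lemma wo_cont_trans : transitive wo_cont.
Proof.
move=> b a c ab bc.
have [|m [[mS mle] _]] := wo_contP (A := pred3 a b c).
  by exists a; rewrite !inE eqxx.
have anti := wo_chain_antisymmetric wo_cont_chain.
move: mS; rewrite !inE => /or3P[] /eqP mE; subst m.
- by apply: mle; rewrite !inE eqxx !orbT.
- have ba : wo_cont b a by apply: mle; rewrite !inE eqxx.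
  by have -> : a = b by apply: anti => //; rewrite ab ba.
- have cb : wo_cont c b by apply: mle; rewrite !inE eqxx orbT.
  by have <- : b = c by apply: anti => //; rewrite bc cb.
Qed.

Fact omega1_le_refl : reflexive omega1_le.
Proof. by move=> a; apply: (wo_chain_reflexive wo_cont_chain). Qed.

Fact omega1_le_anti : antisymmetric omega1_le.
Proof.
by move=> a b ab; apply/omega1_val_inj/(wo_chain_antisymmetric wo_cont_chain).
Qed.

Fact omega1_le_trans : transitive omega1_le.
Proof. by move=> b a c; apply: wo_cont_trans. Qed.

Fact omega1_le_total : total omega1_le.
Proof. by move=> a b; apply: (wo_chainW wo_cont_chain). Qed.

Fact omega1_display : Order.disp_t. Proof. exact: Order.Disp tt tt. Qed.

HB.instance Definition _ := Order.Le_isPOrder.Build omega1_display omega1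
  omega1_le_refl omega1_le_anti omega1_le_trans.
HB.instance Definition _ :=
  Order.POrder_isTotal.Build omega1_display omega1 omega1_le_total.

Lemma omega1_wf (A : set omega1) :
  A !=set0 -> exists2 m, A m & forall a, A a -> m <= a.
Proof.
move=> [a0 Aa0].
have [|m [[/asboolP [a Aa <-] mle] _]] :=
    wo_contP (A := [pred x | `[< (omega1_val @` A) x >]]).
  by exists (omega1_val a0); apply/asboolP; exists a0.
by exists a => // b Ab; apply: mle; apply/asboolP; exists b.
Qed.

Lemma omega1_countable (a : omega1) : countable [set b | b < a].
Proof.
rewrite -(eq_countable (inj_card_eq (f := omega1_val) (in2W omega1_val_inj))).
apply: sub_countable (omega1_valP a); apply: subset_card_le.
by move=> _ [b /= /ltW ba <-].
Qed.

Lemma omega1_uncountable : ~ countable [set: omega1].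
Proof.
move=> cW; have {}cW : countable (range omega1_val).
  exact: sub_countable (card_image_le _ _) cW.
have [[x0 nx0]|allc] :=
    pselect (exists x, ~ countable [set b | wo_cont b x]).
  have [|m [[/asboolP ncm mle] _]] :=
      wo_contP (A := [pred x | `[< ~ countable [set b | wo_cont b x] >]]).
    by exists x0; apply/asboolP.
  apply: ncm; have c2 : countable (range omega1_val `|` [set m]).
    by rewrite -bigcup2E; apply: bigcup_countable => // -[|[|i]] _ /=.
  apply: sub_countable c2; apply: subset_card_le => b /= bm.
  have [cb|ncb] := pselect (countable [set b' | wo_cont b' b]).
    by left; exists (Omega1 cb).
  right; apply: (wo_chain_antisymmetric wo_cont_chain) => //.
  by rewrite bm mle//; apply/asboolP.
have /countable_injP[g ginj] : countable [set: set nat].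
  apply: sub_countable cW; apply: subset_card_le => x _.
  have cx : countable [set b | wo_cont b x].
    by apply: contrapT => ncx; apply: allc; exists x.
  by exists (Omega1 cx).
pose D := [set n | exists2 A : set nat, g A = n & ~ A n].
have [DgD|nDgD] := pselect (D (g D)); last by apply: (nDgD); exists D.
have [A gA nA] := DgD.
by apply: nA; rewrite (ginj A D) ?in_setT.
Qed.

Section OrderNotions.
Context {d1 d2 : Order.disp_t} {X : porderType d1} {Y : porderType d2}.

Definition order_iso (A : set X) (B : set Y) : Prop :=
  exists2 g : X -> Y, set_bij A B g &
    forall x y, A x -> A y -> (g x < g y) = (x < y).

End OrderNotions.

Definition is_limit (a : omega1) : Prop :=
  [set b | b < a] !=set0 /\ forall b, b < a -> exists2 c, b < c & c < a.

(* Only the values of a ladder system at limit ordinals are meaningful. *)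
Definition ladder_system (C : omega1 -> set omega1) : Prop :=
  forall a, is_limit a ->
    [/\ C a `<=` [set b | b < a],
        forall b, b < a -> exists2 c, C a c & b <= c
      & order_iso [set: nat] (C a)].

Section Trees.
Context {d : Order.disp_t} {U : porderType d}.
Implicit Types (s t : U) (a b x : omega1) (A S : set U).

Definition has_height s a : Prop :=
  order_iso [set b | b < a] [set t | t < s].

(* Meaningful only when [s] has a predecessor of height [x], which is then
   unique if [U] is a tree; the default value is [s]. *)
Definition restr s x : U := xget s [set t | t < s /\ has_height t x].

Definition antichain A : Prop :=
  forall s t, A s -> A t -> s <= t -> s = t.

Definition special A : Prop :=
  exists2 F : nat -> set U, (forall n, antichain (F n)) & A = \bigcup_n F n.

Definition subtree S : Prop :=
  (forall s t, S s -> t <= s -> S t) /\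
  forall s a, S s ->
    exists t, [/\ S t, s <= t & exists2 b, has_height t b & a <= b].

(* A colouring is a family [f] of which only the values [f a x], for [a] limit
   and [x] in [C a], matter; likewise only the values of [phi] on [S] matter,
   so that [uniformization C f S phi] is about the restriction of [phi] to [S]. *)
Definition uniformization (C : omega1 -> set omega1)
    (f : omega1 -> omega1 -> nat) S (phi : U -> nat) : Prop :=
  subtree S /\
  forall s a, S s -> is_limit a -> has_height s a ->
    finite_set [set x | C a x /\ phi (restr s x) <> f a x].

End Trees.

Record sigmaQ : Type := SigmaQ {
  sigmaQ_set : set rat;
  sigmaQ_wo : wo_chain <=%O (mem sigmaQ_set);
  sigmaQ_bounded : has_ubound sigmaQ_set }.

HB.instance Definition _ := gen_eqMixin sigmaQ.
HB.instance Definition _ := gen_choiceMixin sigmaQ.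

Definition end_extends (t s : set rat) : Prop :=
  s `<=` t /\ forall x y, s x -> t y -> ~ s y -> x < y.

Definition sigmaQ_le (s t : sigmaQ) : bool :=
  `[< end_extends (sigmaQ_set t) (sigmaQ_set s) >].

Fact sigmaQ_le_refl : reflexive sigmaQ_le.
Proof. by move=> s; apply/asboolP; split. Qed.

Fact sigmaQ_le_anti : antisymmetric sigmaQ_le.
Proof.
move=> [A wA bA] [B wB bB] /andP[/asboolP[/= AB _] /asboolP[/= BA _]].
have E : A = B by apply/seteqP.
by subst B; congr SigmaQ; exact: Prop_irrelevance.
Qed.

Fact sigmaQ_le_trans : transitive sigmaQ_le.
Proof.
move=> t s u /asboolP[st st'] /asboolP[tu tu']; apply/asboolP.
split=> [x /st /tu //|x y sx uy nsy].
by have [ty|nty] := pselect (sigmaQ_set t y); [exact: st'|apply: tu' => //; exact: st].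
Qed.

Fact sigmaQ_display : Order.disp_t. Proof. exact: Order.Disp tt tt. Qed.

HB.instance Definition _ := Order.Le_isPOrder.Build sigmaQ_display sigmaQ
  sigmaQ_le_refl sigmaQ_le_anti sigmaQ_le_trans.

(* Main.v *)
Require Import Defs.
From HB Require Import structures.
From mathcomp Require Import all_boot all_order all_algebra.
From mathcomp Require Import boolp classical_sets functions cardinality wochoice.
From mathcomp Require Import lra.
Local Open Scope classical_set_scope.

(* Colour the rationals by a map with dense fibres and let h(s) be the colour of
   sup s whenever it is rational. T consists of all nodes below which every node
   of limit height obeys the colouring. A node of T can be extended within T to
   any larger height, with all new points in a given interval (a, b) and with a
   prescribed value of h at the top: at limit steps follow the ladder and let the
   suprema converge to a rational of the desired colour.

   If T were the union of antichains A_n, take countable families M_0, M_1, ...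
   of nodes of heights below d_0 < d_1 < ..., each closed under the extension
   property and under picking elements of A_n that extend a given node inside a
   given interval, and let a = sup d_n. Since the ladder at a has only finitely
   many points below d_n, step n can first pass all of them inside M_n and then
   enter A_n, if that is possible, without meeting another ladder point. The
   union of the resulting chain has height a and lies in T, but in no A_n. *)

Set Implicit Arguments.
Unset Strict Implicit.
Unset Printing Implicit Defensive.

Import Order.TTheory GRing.Theory Num.Theory.
Local Open Scope order_scope.

(** * A colouring of the rationals with dense fibres *)

Definition rat_colour (r : rat) : nat := logn 2 `|denq r|.

(** The fraction need not be reduced, so exponents of 2 are compared in the cross-multiplied
    identity [E]. By coprimality the numerator or the denominator of [r] is odd; in the second case
    both summands in [L] vanish. *)
Lemma rat_colour_frac (r : rat) (m : int) (n D : nat) :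
  odd `|m| -> odd D -> (r * (2 ^ n * D)%:R = m%:~R)%R -> rat_colour r = n.
Proof.
move=> om oD rE.
have nzP k : odd k -> (0 < k)%N by case: k.
have E : (`|m| * `|denq r| = `|numq r| * (2 ^ n * D))%N.
  have : (m * denq r = numq r * (2 ^ n * D)%:R)%R.
    apply: (@intr_inj rat); rewrite !rmorphM/= -rE mulrAC numqE.
    by rewrite !rmorph_nat natrM.
  by move=> /(congr1 absz); rewrite !abszM natz.
have num_gt0 : (0 < `|numq r|)%N.
  have : (0 < `|m| * `|denq r|)%N by rewrite muln_gt0 nzP//= absz_gt0 denq_eq0.
  by rewrite E muln_gt0 => /andP[].
have logo k : odd k -> logn 2 k = 0%N.
  by move=> ok; apply/eqP; rewrite lognE/= nzP//= dvdn2 ok.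
have : (logn 2 (`|m| * `|denq r|) = logn 2 (`|numq r| * (2 ^ n * D)))%N by rewrite E.
rewrite !lognM ?muln_gt0 ?expn_gt0 ?(nzP _ om) ?(nzP _ oD) ?num_gt0 ?absz_gt0 ?denq_eq0//.
rewrite pfactorK// (logo _ om) (logo _ oD) add0n addn0 /rat_colour => L; rewrite L.
have [on|en] := boolP (odd `|numq r|); first by rewrite (logo _ on).
have od : odd `|denq r|.
  have cop := coprime_num_den r.
  have : coprime 2 `|denq r| by apply: coprime_dvdl cop; rewrite dvdn2.
  by rewrite coprime2n.
by move: L; rewrite (logo _ od) => /esym/eqP; rewrite addn_eq0 => /andP[/eqP-> /eqP->].
Qed.

Lemma rat_colour_dense (a b : rat) (n : nat) : a < b ->
  exists r, [/\ a < r, r < b & rat_colour r = n].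
Proof.
move=> ab.
have [k kE] : exists k : nat, (2 / (b - a) < k%:R :> rat)%R.
  have := archi_boundP (x := (2 / (b - a))%R).
  rewrite divr_ge0 ?subr_ge0 ?ltW// => /(_ isT) ?.
  by exists (Num.bound (2 / (b - a))%R).
(* An odd [D] keeps the exponent of 2 in [N] equal to [n], and [D >= k] makes [1 / N] less than half
   of [b - a]. *)
pose D := k.*2.+1; pose N := (2 ^ n * D)%N.
have oD : odd D by rewrite /= odd_double.
have Nk : (k%:R <= N%:R :> rat)%R.
  rewrite ler_nat /N /D; apply: (@leq_trans k.*2.+1).
    by rewrite -addnn leqW// leq_addr.
  by rewrite leq_pmull// expn_gt0.
have N0 : (0 < N%:R :> rat)%R by rewrite ltr0n muln_gt0 expn_gt0.
have big : (2 < (b - a) * N%:R)%R.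
  have ba : (0 < b - a)%R by rewrite subr_gt0.
  have := lt_le_trans kE Nk; rewrite ltr_pdivrMr// mulrC; lra.
pose m0 := Num.floor (a * N%:R)%R.
have m0le : (m0%:~R <= a * N%:R :> rat)%R by rewrite ge_floor.
have m0gt : (a * N%:R < m0%:~R + 1 :> rat)%R.
  by have := floorD1_gt (a * N%:R)%R; rewrite intrD.
(* Both [m0 + 1] and [m0 + 2] lie strictly between [a * N] and [b * N], and one of them is odd. *)
have [m [om m1 m2]] : exists m : int,
    [/\ odd `|m|, (m0%:~R + 1 <= m%:~R :> rat)%R & (m%:~R <= m0%:~R + 2 :> rat)%R].
  have parity (z : int) : odd `|(z + 1)%R| = ~~ odd `|z|.
    have : (~~ odd `|(z + 1)%R| = odd `|z|); last by move=> <-; rewrite negbK.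
    by case: z => [z|[|z]] //; rewrite -?PoszD ?addn1//= ?negbK// subn1.
  have [o1|e1] := boolP (odd `|(m0 + 1)%R|).
    by exists (m0 + 1)%R; split; rewrite ?intrD//; lra.
  exists (m0 + 1 + 1)%R; rewrite parity e1 !intrD; split=> //; lra.
exists (m%:~R / N%:R)%R; split.
- by rewrite ltr_pdivlMr//; lra.
- by rewrite ltr_pdivrMr//; lra.
- by apply: (@rat_colour_frac _ m n D) => //; rewrite divfK ?gt_eqF.
Qed.

(** * Countability and strict suprema in [omega1] *)

Lemma countableU2 (X : Type) (A B : set X) :
  countable A -> countable B -> countable (A `|` B).
Proof.
by move=> cA cB; rewrite -bigcup2E; apply: bigcup_countable => // -[|[|i]] _ /=.
Qed.

Lemma countable_imageS (X Y : Type) (F : X -> Y) (A : set X) :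
  countable A -> countable (F @` A).
Proof. by apply: sub_countable; exact: card_image_le. Qed.

(** Otherwise [omega1] would be a countable union of countable initial segments. *)
Lemma omega1_ltP (A : set omega1) : countable A -> exists m, forall a, A a -> a < m.
Proof.
move=> cA; apply: contrapT => nm; apply: omega1_uncountable.
have -> : [set: omega1] = \bigcup_(a in A) [set b | b <= a].
  apply/seteqP; split=> // m _; apply: contrapT => H; apply: nm; exists m => a Aa.
  by rewrite ltNge; apply/negP => ma; apply: H; exists a.
apply: bigcup_countable => // a _.
have -> : [set b | b <= a] = ([set b | b < a] `|` [set a])%classic.
  apply/seteqP; split=> b /=; rewrite le_eqVlt.
    by case/orP=> [/eqP|]; [right|left].
  by move=> [->|->]; rewrite ?eqxx ?orbT.
by apply: countableU2 => //; exact: omega1_countable.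
Qed.

Lemma omega1_point : exists a : omega1, True.
Proof. by have [m _] := omega1_ltP (@countable0 omega1); exists m. Qed.

Definition omega1_pt : omega1 := projT1 (cid omega1_point).

Definition is_ssup (A : set omega1) (m : omega1) : Prop :=
  (forall a, A a -> a < m) /\ forall m', (forall a, A a -> a < m') -> m <= m'.

Definition ssup (A : set omega1) : omega1 := xget omega1_pt (is_ssup A).

Lemma ssupP (A : set omega1) : countable A -> is_ssup A (ssup A).
Proof.
move=> /omega1_ltP Am; apply: xgetPex.
by have [m mP mle] := omega1_wf (A := [set m | forall a, A a -> a < m]) Am; exists m.
Qed.

Lemma ssup_gt (A : set omega1) a : countable A -> A a -> a < ssup A.
Proof. by move=> /ssupP[+ _]; exact. Qed.

Lemma lt_ssup (A : set omega1) b : countable A -> b < ssup A ->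
  exists2 a, A a & b <= a.
Proof.
move=> /ssupP[_ le] ltb; apply: contrapT => H.
have : ssup A <= b.
  by apply: le => a Aa; rewrite ltNge; apply/negP => ba; apply: H; exists a.
by rewrite leNgt ltb.
Qed.

Lemma omega1_ind (P : omega1 -> Prop) :
  (forall a, (forall b, b < a -> P b) -> P a) -> forall a, P a.
Proof.
move=> step a; apply: contrapT => nPa.
have [|m nPm mle] := omega1_wf (A := [set x | ~ P x]); first by exists a.
apply: nPm; apply: step => b bm; apply: contrapT => nPb.
by have := mle b nPb; rewrite leNgt bm.
Qed.

(** * Initial segments and heights in [sigmaQ] *)

Lemma sigmaQ_least (s : sigmaQ) (B : set rat) :
  B `<=` sigmaQ_set s -> B !=set0 -> exists2 m, B m & forall y, B y -> m <= y.
Proof.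
move=> Bs [y0 By0].
have [x||m [[/asboolP Bm mle] _]] := sigmaQ_wo (s := s) (A := [pred x | `[< B x >]]).
- by move=> /asboolP Bx; apply/mem_set/Bs.
- by exists y0; apply/asboolP.
- by exists m => // y By; apply: mle; apply/asboolP.
Qed.

Lemma wo_chain_rat (S : set rat) :
  (forall B : set rat, B `<=` S -> B !=set0 ->
    exists2 m, B m & forall y, B y -> m <= y) ->
  wo_chain <=%O (mem S).
Proof.
move=> least; apply: antisymmetric_wo_chain; first by move=> x y _ _; exact: le_anti.
move=> A AS [y yA]; have [x /AS||m Am mle] := least [set x | x \in A].
- by rewrite /= !inE.
- by exists y.
- by exists m; split.
Qed.

Lemma sigmaQ_eq (s t : sigmaQ) : sigmaQ_set s = sigmaQ_set t -> s = t.
Proof.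
case: s t => [A wA bA] [B wB bB] /= E; subst B.
by congr SigmaQ; exact: Prop_irrelevance.
Qed.

Lemma sigmaQ_leP (s t : sigmaQ) :
  reflect (end_extends (sigmaQ_set t) (sigmaQ_set s)) (s <= t).
Proof. exact: asboolP. Qed.

Lemma sigmaQ_le_sub (s t : sigmaQ) : s <= t -> sigmaQ_set s `<=` sigmaQ_set t.
Proof. by move=> /sigmaQ_leP[]. Qed.

Lemma cut_wo (s : sigmaQ) (x : rat) :
  wo_chain <=%O (mem [set y | sigmaQ_set s y /\ y < x]).
Proof. by apply: wo_chain_rat => B Bs; apply: (@sigmaQ_least s) => y /Bs[]. Qed.

Lemma cut_bounded (s : sigmaQ) (x : rat) :
  has_ubound [set y | sigmaQ_set s y /\ y < x].
Proof. by exists x => y [_ /ltW]. Qed.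

Definition cut (s : sigmaQ) (x : rat) : sigmaQ :=
  SigmaQ (@cut_wo s x) (cut_bounded s x).

(** A proper initial segment is the cut at the least element that it omits. *)
Lemma sigmaQ_ltP (s t : sigmaQ) :
  t < s <-> exists2 x, sigmaQ_set s x & t = cut s x.
Proof.
split=> [|[x sx ->]].
  rewrite lt_neqAle => /andP[/eqP ts /sigmaQ_leP[sub ext]].
  have [| |x [sx ntx] xle] :=
      @sigmaQ_least s [set y | sigmaQ_set s y /\ ~ sigmaQ_set t y].
  - by move=> y [].
  - apply: contrapT => H; apply: ts; apply: sigmaQ_eq; apply/seteqP; split=> // y sy.
    by apply: contrapT => nty; apply: H; exists y.
  - exists x => //; apply: sigmaQ_eq; apply/seteqP; split=> y /=.
      by move=> ty; split; [exact: sub|exact: ext].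
    by move=> [sy yx]; apply: contrapT => nty; have := xle y (conj sy nty); rewrite leNgt yx.
rewrite lt_neqAle; apply/andP; split.
  apply/eqP => E; have : sigmaQ_set (cut s x) x by rewrite E.
  by case; rewrite ltxx.
apply/sigmaQ_leP; split=> [y []//|y z [_ yx] sz nz].
by apply: lt_le_trans yx _; rewrite leNgt; apply/negP => zx; apply: nz.
Qed.

Lemma cut_le (s : sigmaQ) (x y : rat) : x <= y -> cut s x <= cut s y.
Proof.
move=> xy; apply/sigmaQ_leP; split=> [z [sz zx]|z u [sz zx] [su uy] nu].
  by split=> //; exact: lt_le_trans zx xy.
by apply: lt_le_trans zx _; rewrite leNgt; apply/negP => ux; apply: nu.
Qed.

Lemma sigmaQ_comparable (s t u : sigmaQ) : t <= s -> u <= s -> t <= u \/ u <= t.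
Proof.
rewrite le_eqVlt => /orP[/eqP->|ts]; first by right.
rewrite le_eqVlt => /orP[/eqP->|us]; first by left; exact: ltW.
have [x _ ->] := (sigmaQ_ltP s t).1 ts; have [y _ ->] := (sigmaQ_ltP s u).1 us.
by have [xy|/ltW yx] := leP x y; [left|right]; exact: cut_le.
Qed.

(** A least [m] in [s] with [cut s m] inaccessible cannot exist, since the predecessors of [cut s m]
    are the cuts of [s] at smaller points. *)
Lemma sigmaQ_lt_wf : well_founded (fun t s : sigmaQ => t < s).
Proof.
move=> s; constructor=> t /sigmaQ_ltP[x sx ->]; apply: contrapT => nacc.
have [| |m [sm nm] mle] := @sigmaQ_least s
    [set y | sigmaQ_set s y /\ ~ Acc (fun t s : sigmaQ => t < s) (cut s y)].
- by move=> y [].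
- by exists x.
apply: nm; constructor=> u /sigmaQ_ltP[y [sy ym] ->].
have -> : cut (cut s m) y = cut s y.
  apply: sigmaQ_eq; apply/seteqP; split=> z /=; first by move=> [[]].
  by move=> [sz zy]; split=> //; split=> //; exact: lt_trans zy ym.
by apply: contrapT => nacc'; have := mle y (conj sy nacc'); rewrite leNgt ym.
Qed.

Lemma countable_lt_sigmaQ (s : sigmaQ) : countable [set t | t < s].
Proof.
apply: sub_countable (countable_imageS (cut s) (countableP (sigmaQ_set s))).
by apply: subset_card_le => t /sigmaQ_ltP[x sx ->]; exists x.
Qed.

(** The rank function, a total substitute for the relation [has_height]; [has_heightP] identifies
    the two. *)
Definition ht : sigmaQ -> omega1 :=
  Fix sigmaQ_lt_wf (fun=> omega1)
    (fun s rec => ssup [set a | exists t (p : t < s), a = rec t p]).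

Lemma htE (s : sigmaQ) : ht s = ssup (ht @` [set t | t < s]).
Proof.
rewrite /ht Fix_eq; last first.
  move=> {}s F G FG; congr ssup; apply/seteqP; split=> a [t [p ->]];
  by exists t, p; rewrite FG.
congr ssup; apply/seteqP; split=> a; first by move=> [t [p ->]]; exists t.
by move=> [t p <-]; exists t, p.
Qed.

Lemma ht_lt (s t : sigmaQ) : t < s -> ht t < ht s.
Proof.
move=> ts; rewrite (htE s); apply: ssup_gt; last by exists t.
exact/countable_imageS/countable_lt_sigmaQ.
Qed.

Lemma ht_le (s t : sigmaQ) : t <= s -> ht t <= ht s.
Proof. by rewrite le_eqVlt => /orP[/eqP->//|/ht_lt/ltW]. Qed.

Lemma ht_lt_ex (s : sigmaQ) b : b < ht s -> exists2 t, t < s & b <= ht t.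
Proof.
rewrite htE => /lt_ssup[|_ [t ts <-] bt]; last by exists t.
exact/countable_imageS/countable_lt_sigmaQ.
Qed.

Lemma ht_eq (s : sigmaQ) a : (forall t, t < s -> ht t < a) ->
  (forall b, b < a -> exists2 t, t < s & b <= ht t) -> ht s = a.
Proof.
move=> H1 H2; apply/eqP; rewrite eq_le; apply/andP; split; rewrite leNgt; apply/negP.
  by move=> /ht_lt_ex[t /H1]; rewrite ltNge => /negP.
by move=> /H2[t /ht_lt]; rewrite ltNge => /negP.
Qed.

Lemma ht_pred (s : sigmaQ) b : b < ht s -> exists2 t, t < s & ht t = b.
Proof.
elim/(well_founded_ind sigmaQ_lt_wf): s => s IH /ht_lt_ex[t ts].
rewrite le_eqVlt => /orP[/eqP->|]; first by exists t.
by move=> /(IH t ts)[u ut <-]; exists u => //; exact: lt_trans ut ts.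
Qed.

Lemma ht_pred_le (s : sigmaQ) b : b <= ht s -> exists2 t, t <= s & ht t = b.
Proof.
rewrite le_eqVlt => /orP[/eqP->|/ht_pred[t /ltW]]; first by exists s.
by exists t.
Qed.

Lemma ht_inj_below (s t u : sigmaQ) : t <= s -> u <= s -> ht t = ht u -> t = u.
Proof.
move=> ts us E; have [] := sigmaQ_comparable ts us; rewrite le_eqVlt => /orP[/eqP//|/ht_lt].
  by rewrite E ltxx.
by rewrite E ltxx.
Qed.

(** By induction, an isomorphism sends [b] to a node of rank [b]. Conversely, sending [b] to the
    predecessor of rank [b] is an isomorphism, because the predecessors of [s] are comparable. *)
Lemma has_heightP (s : sigmaQ) a : has_height s a <-> ht s = a.
Proof.
split=> [[g [gf gi gs] gm]|<-].
  have hg b : b < a -> ht (g b) = b.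
    elim/omega1_ind: b => b IH ba.
    have sub c : c < b -> c < a by move=> cb; exact: lt_trans cb ba.
    apply: ht_eq => [t tb|c cb].
      have /gs[c ca E] : t < s by exact: lt_trans tb (gf _ ba).
      by move: tb; rewrite -E gm// => cb; rewrite IH.
    by have ca := sub _ cb; exists (g c); rewrite ?gm ?IH.
  apply: ht_eq => [t /gs[b ba <-]|b ba]; first by rewrite hg.
  by exists (g b); [exact: gf|rewrite hg].
pose g b := xget s [set t | t < s /\ ht t = b].
have gP b : b < ht s -> g b < s /\ ht (g b) = b.
  by move=> /ht_pred[t ts tb]; 
  exact: (@xgetI _ s [set t | t < s /\ ht t = b] t (conj ts tb)).
exists g; first split.
- by move=> b /= /gP[].
- by move=> b c; rewrite !inE => /gP[_ Eb] /gP[_ Ec] E; rewrite -Eb E.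
- move=> t /= ts; exists (ht t); first exact: ht_lt.
  have [gl ge] := gP _ (ht_lt ts).
  exact: ht_inj_below (ltW gl) (ltW ts) ge.
move=> x y /gP[xs xE] /gP[ys yE]; apply/idP/idP => [/ht_lt|]; first by rewrite xE yE.
rewrite -{1}xE -{1}yE => lt; have [] := sigmaQ_comparable (ltW xs) (ltW ys).
  by rewrite le_eqVlt => /orP[/eqP E|//]; move: lt; rewrite E ltxx.
by move=> /ht_le; rewrite leNgt lt.
Qed.

(* At [t = s] this is the default value of [restr]. *)
Lemma restr_ht (s t : sigmaQ) : t <= s -> restr s (ht t) = t.
Proof.
rewrite le_eqVlt => /orP[/eqP->|ts].
  by apply: xgetPN => u [us /has_heightP E]; have := ht_lt us; rewrite E ltxx.
apply: xget_unique; first by split=> //; exact/has_heightP.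
move=> u [us /has_heightP E].
exact: ht_inj_below (ltW us) (ltW ts) E.
Qed.

Lemma restr_le (s t : sigmaQ) x : t <= s -> x <= ht t -> restr s x = restr t x.
Proof.
move=> ts /ht_pred_le[u ut <-]; rewrite !restr_ht//; exact: le_trans ut ts.
Qed.

(** The invariant may change with the stage, so choice is applied to pairs of a stage and a point,
    with a dummy value where the invariant fails. *)
Lemma dependent_choice_nat (X : Type) (P : nat -> X -> Prop)
    (R : nat -> X -> X -> Prop) (x0 : X) :
  P 0%N x0 -> (forall n x, P n x -> exists y, P n.+1 y /\ R n x y) ->
  exists u : nat -> X,
    [/\ u 0%N = x0, forall n, P n (u n) & forall n, R n (u n) (u n.+1)].
Proof.
move=> P0 step.
have /choice[F FP] : forall nx : nat * X, exists y,
    P nx.1 nx.2 -> P nx.1.+1 y /\ R nx.1 nx.2 y.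
  move=> [n x]; have [/step[y yP]|nP] := pselect (P n x); first by exists y.
  by exists x.
pose u := fix u n := if n is m.+1 then F (m, u m) else x0.
have uP n : P n (u n) by elim: n => // n IH; have [] := FP (n, u n) IH.
by exists u; split=> // n; have [] := FP (n, u n) (uP n).
Qed.

(** * Extensions with new points in a prescribed interval *)

(** Confining new points keeps unions of chains bounded, and shrinking the interval preserves
    promises about all later extensions. *)
Definition ext (s : sigmaQ) (a b : rat) (t : sigmaQ) : Prop :=
  s <= t /\ forall y, sigmaQ_set t y -> ~ sigmaQ_set s y -> a < y < b.

Lemma ext_refl s a b : ext s a b s.
Proof. by split. Qed.

Lemma ext_sub s t a b a' b' : a' <= a -> b <= b' -> ext s a b t -> ext s a' b' t.
Proof.
move=> aa bb [st new]; split=> // y ty nsy; have /andP[ay yb] := new y ty nsy.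
by rewrite (le_lt_trans aa ay) (lt_le_trans yb bb).
Qed.

Lemma ext_trans s t u a b : ext s a b t -> ext t a b u -> ext s a b u.
Proof.
move=> [st new1] [tu new2]; split; first exact: le_trans st tu.
move=> y uy nsy; have [ty|nty] := pselect (sigmaQ_set t y); first exact: new1.
exact: new2.
Qed.

Lemma ext_ubound s t a b : ubound (sigmaQ_set s) a -> a < b -> ext s a b t ->
  ubound (sigmaQ_set t) b.
Proof.
move=> ub ab [_ new] y ty; have [/ub ya|/(new y ty)/andP[_ /ltW//]] :=
  pselect (sigmaQ_set s y).
exact: le_trans ya (ltW ab).
Qed.

Lemma ext_chain (s : nat -> sigmaQ) (a b : nat -> rat) :
  (forall n, a n <= a n.+1) -> (forall n, b n.+1 <= b n) ->
  (forall n, ext (s n) (a n) (b n) (s n.+1)) ->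
  forall n m, ext (s n) (a n) (b n) (s (n + m)%N).
Proof.
move=> am bm sE n m.
have amon k : a n <= a (n + k)%N.
  by elim: k => [|k IH]; rewrite ?addn0// addnS (le_trans IH).
have bmon k : b (n + k)%N <= b n.
  by elim: k => [|k IH]; rewrite ?addn0// addnS (le_trans (bm _)).
elim: m => [|m IH]; first by rewrite addn0; exact: ext_refl.
by rewrite addnS; apply: ext_trans IH _; exact: ext_sub (amon m) (bmon m) (sE _).
Qed.

(** Points added after stage [n] lie above all of [s n], so a set has its least element inside any
    [s n] that it meets. Boundedness comes from [b 0]. *)
Lemma ext_union (s : nat -> sigmaQ) (a b : nat -> rat) :
  ubound (sigmaQ_set (s 0%N)) (a 0%N) -> a 0%N < b 0%N ->
  (forall n, a n <= a n.+1) -> (forall n, b n.+1 <= b n) ->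
  (forall n, ext (s n) (a n) (b n) (s n.+1)) ->
  exists2 u, forall y, sigmaQ_set u y -> exists n, sigmaQ_set (s n) y &
    forall n, ext (s n) (a n) (b n) u.
Proof.
move=> ub ab am bm sE; have sC := ext_chain am bm sE.
have smon n m : (n <= m)%N -> s n <= s m.
  by move=> nm; rewrite -(subnKC nm); have [] := sC n (m - n)%N.
pose S := \bigcup_n sigmaQ_set (s n).
have send n x y : sigmaQ_set (s n) x -> S y -> ~ sigmaQ_set (s n) y -> x < y.
  move=> snx [m _ smy] nsny; have [nm|/ltnW mn] := leqP n m.
    by have /sigmaQ_leP[_] := smon _ _ nm; apply.
  by case: nsny; exact: sigmaQ_le_sub (smon _ _ mn) _ smy.
have Swo : wo_chain <=%O (mem S).
  apply: wo_chain_rat => B BS [y By]; have [n _ sny] := BS _ By.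
  have [| |m [Bm snm] mle] :=
    @sigmaQ_least (s n) (B `&` sigmaQ_set (s n))%classic.
  - by move=> x [].
  - by exists y.
  exists m => // z Bz; have [snz|nsnz] := pselect (sigmaQ_set (s n) z).
    exact: mle.
  by apply: ltW; apply: send snm _ nsnz; exact: BS.
have Sub : has_ubound S.
  exists (b 0%N) => y [n _ sny]; apply: ext_ubound ub ab _ _ sny.
  exact: sC 0%N n.
exists (SigmaQ Swo Sub) => [y [n _]|n]; first by exists n.
split=> [|y [m _ smy] nsny].
  by apply/sigmaQ_leP; split=> [x snx|x y snx]; [exists n|exact: send].
have [nm|/ltnW mn] := leqP n m.
  by have [_ new] := sC n (m - n)%N; move: new; rewrite subnKC//; apply.
by case: nsny; exact: sigmaQ_le_sub (smon _ _ mn) _ smy.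
Qed.

(** Cutting [t] at its new maximum [r] gives back [s], so [t] is an immediate successor. *)
Lemma add_point (s : sigmaQ) (r : rat) : (forall y, sigmaQ_set s y -> y < r) ->
  exists t, [/\ sigmaQ_set t = (sigmaQ_set s `|` [set r])%classic, s < t
              & forall u, u < t -> u <= s].
Proof.
move=> sr; pose S := (sigmaQ_set s `|` [set r])%classic.
have Swo : wo_chain <=%O (mem S).
  apply: wo_chain_rat => B BS [y By].
  have [[z [Bz sz]]|none] := pselect (B `&` sigmaQ_set s !=set0)%classic.
    have [| |m [Bm sm] mle] := @sigmaQ_least s (B `&` sigmaQ_set s)%classic.
    - by move=> x [].
    - by exists z.
    exists m => // x Bx; have [sx|->] := BS _ Bx; first exact: mle.
    exact/ltW/sr.
  have Br x : B x -> x = r.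
    by move=> Bx; have [sx|//] := BS _ Bx; case: none; exists x.
  by exists y => // x Bx; rewrite (Br _ Bx) (Br _ By).
have Sub : has_ubound S by exists r => y [/sr/ltW//|->].
pose t := SigmaQ Swo Sub.
have cutr : cut t r = s.
  apply: sigmaQ_eq; apply/seteqP; split=> [y [[//|->]]|y sy].
    by rewrite ltxx.
  by split; [left|exact: sr].
exists t; split=> //; first by apply/sigmaQ_ltP; exists r => //; right.
move=> u /sigmaQ_ltP[x [sx|->] ->]; last by rewrite cutr.
by rewrite -cutr; apply: cut_le; exact/ltW/sr.
Qed.

(** * The uniformizing function *)

Definition is_lub (s : sigmaQ) (r : rat) : Prop :=
  ubound (sigmaQ_set s) r /\ forall q, ubound (sigmaQ_set s) q -> r <= q.

(* Nodes without a rational supremum get the irrelevant value [rat_colour 0]. *)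
Definition sup_colour (s : sigmaQ) : nat := rat_colour (xget 0%R (is_lub s)).

Lemma sup_colour_lub s r : is_lub s r -> sup_colour s = rat_colour r.
Proof.
move=> [ub le]; congr rat_colour; apply: xget_unique => // q [ub' le'].
by apply/eqP; rewrite eq_le le' ?le.
Qed.

(** Imposing the condition at every [t <= s], not at [s] alone, makes the set downward closed. *)
Definition utree (C : omega1 -> set omega1) (f : omega1 -> omega1 -> nat) :
    set sigmaQ :=
  [set s | forall t, t <= s -> is_limit (ht t) ->
    finite_set [set x | C (ht t) x /\ sup_colour (restr t x) <> f (ht t) x]].

Lemma utree_le C f s t : utree C f s -> t <= s -> utree C f t.
Proof. by move=> Ts ts u ut; apply: Ts; exact: le_trans ut ts. Qed.

(** * Ladders and nodes of limit height *)

Lemma ladder_enum C a : ladder_system C -> is_limit a ->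
  exists g : nat -> omega1,
    [/\ forall k, C a (g k) /\ g k < a, forall x, C a x -> exists k, x = g k,
        forall i j, (g i < g j) = (i < j)%N
      & forall b, b < a -> exists k, b < g k].
Proof.
move=> lC la; have [Ca cof [g [gf gi gs] gm]] := lC _ la.
have gC k : C a (g k) by exact: gf.
have gS x : C a x -> exists k, x = g k by move=> /gs[k _ <-]; exists k.
exists g; split=> // [k|i j|b ba]; first by split=> //; exact: Ca.
  by rewrite gm// ltEnat.
have [c bc ca] := la.2 _ ba; have [x /gS[k ->] cx] := cof _ ca.
by exists k; exact: lt_le_trans bc cx.
Qed.

Lemma ladder_finite C a b : ladder_system C -> is_limit a -> b < a ->
  finite_set [set x | C a x /\ x <= b].
Proof.
move=> lC la ba; have [g [_ gS gm gcof]] := ladder_enum lC la.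
have [k bk] := gcof _ ba.
apply: sub_finite_set (finite_image g (finite_II k)) => x [/gS[j ->] jb].
by exists j => //=; rewrite -gm; exact: le_lt_trans jb bk.
Qed.

(** A ladder point above [ht (s 0)] falls between the heights of two consecutive nodes, where its
    colour is correct; only finitely many others exist. A proper predecessor of [u] is a cut at a
    point of some [s n], hence lies below [s n]. *)
Lemma utree_limit C f a (s : nat -> sigmaQ) (u : sigmaQ) :
  ladder_system C -> is_limit a ->
  (forall n, utree C f (s n)) -> (forall n, s n <= s n.+1) ->
  (forall n, s n <= u) -> (forall y, sigmaQ_set u y -> exists n, sigmaQ_set (s n) y) ->
  (forall n, ht (s n) < a) -> (forall b, b < a -> exists n, b <= ht (s n)) ->
  (forall n x, C a x -> ht (s n) < x -> x <= ht (s n.+1) ->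
    sup_colour (restr (s n.+1) x) = f a x) ->
  [/\ ht u = a, utree C f u & forall n, s n < u].
Proof.
move=> lC la Ts smon su us sa scof sf.
have below v : v < u -> exists n, v <= s n.
  move=> vu; have [x ux E] := (sigmaQ_ltP _ _).1 vu; have [n snx] := us _ ux.
  exists n; have [//|/sigmaQ_le_sub/(_ _ snx)] := sigmaQ_comparable (ltW vu) (su n).
  by rewrite E => -[_]; rewrite ltxx.
have slt n : s n < u.
  rewrite lt_neqAle su andbT; apply/eqP => E.
  have [c lc ca] := la.2 _ (sa n); have [m cm] := scof _ ca.
  by have := lt_le_trans lc (le_trans cm (ht_le (su m))); rewrite E ltxx.
have hu : ht u = a.
  apply: ht_eq => [v /below[n /ht_le vn]|b /scof[n bn]].
    exact: le_lt_trans vn (sa n).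
  by exists (s n).
split=> // v; rewrite le_eqVlt => /orP[/eqP-> _|/below[n vn]]; last exact: Ts vn.
rewrite hu; apply: sub_finite_set (ladder_finite lC la (sa 0%N)) => x [Cx nx].
split=> //; rewrite leNgt; apply/negP => x0; apply: nx.
have [Ca _ _] := lC _ la; have xn := scof x (Ca _ Cx).
(* The least stage reaching [x] is not [0], so [x] lies strictly above the height of the preceding
   node. *)
case: (ex_minnP xn) => -[|n] xle nmin; first by move: xle; rewrite leNgt x0.
rewrite (restr_le (su n.+1) xle) sf// ltNge; apply/negP => /nmin.
by rewrite ltnn.
Qed.

(* [M] need only be closed under extensions with one prescribed colour:
   the ladder points are met one after the other. *)
Lemma ladder_step (C : omega1 -> set omega1) (f : omega1 -> omega1 -> nat) a
    (g : nat -> omega1) (M : set sigmaQ) (d : omega1) :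
  (forall x, C a x -> exists k, x = g k) ->
  (forall i j, (g i < g j) = (i < j)%N) ->
  (forall s p q x n, M s -> ubound (sigmaQ_set s) p -> p < q -> ht s < x -> x < d ->
    exists t, [/\ M t, ht t = x, sup_colour t = n & ext s p q t]) ->
  forall k s p q, (forall i, (i < k)%N -> g i < d) -> M s ->
    ubound (sigmaQ_set s) p -> p < q ->
  exists t, [/\ M t, ext s p q t, forall i, (i < k)%N -> g i <= ht t
    & forall x, C a x -> ht s < x -> x <= ht t -> sup_colour (restr t x) = f a x].
Proof.
move=> gS gm Mext; elim=> [|k IH] s p q gd Ms ub pq.
  exists s; split=> //.
  by move=> x _ sx; rewrite leNgt sx.
(* The first half of the interval serves the first [k] ladder points, the second half serves
   [g k]. *)
have [pr rq] := midf_lt pq; set r := ((p + q) / 2)%R in pr rq.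
have [t1 [Mt1 e1 le1 f1]] := IH s p r (fun i ik => gd i (leqW ik)) Ms ub pr.
have ub1 := ext_ubound ub pr e1.
have [kt|tk] := leP (g k) (ht t1).
  exists t1; split=> //; first exact: ext_sub (lexx _) (ltW rq) e1.
  by move=> i; rewrite ltnS leq_eqVlt => /orP[/eqP->|/le1].
have [t [Mt htt ct e2]] := Mext t1 r q (g k) (f a (g k)) Mt1 ub1 rq tk (gd k (ltnSn k)).
have t1t : t1 <= t by case: e2.
exists t; split=> //.
- apply: ext_trans (ext_sub (lexx _) (ltW rq) e1) _.
  exact: ext_sub (ltW pr) (lexx _) e2.
- move=> i; rewrite ltnS htt leq_eqVlt => /orP[/eqP->//|ik].
  by rewrite ltW// gm.
move=> x Cx sx; rewrite htt => xk; have [xt1|t1x] := leP x (ht t1).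
  by rewrite (restr_le t1t xt1) f1.
(* Ladder points of index below [k] are already at most [ht t1], which leaves only [g k]. *)
have [j xj] := gS _ Cx; have -> : x = g k.
  apply/eqP; rewrite eq_le xk xj leNgt gm; apply/negP => /le1; rewrite -xj.
  by rewrite leNgt t1x.
by rewrite -htt restr_ht// ct htt.
Qed.

(** * Extending nodes to a prescribed height and colour *)

Lemma rat_approx (a x : rat) : a < x -> exists q : nat -> rat,
  [/\ q 0%N = a, forall n, q n < q n.+1, forall n, q n < x
    & forall r, r < x -> exists n, r < q n].
Proof.
move=> ax; have d0 : (0 < x - a)%R by rewrite subr_gt0.
(* The shift [n.+1] makes the sequence start exactly at [a]. *)
exists (fun n => x - (x - a) / n.+1%:R)%R; split=> [|n|n|r rx].
- by rewrite divr1 subKr.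
- by rewrite ltrD2l ltrN2 ltr_pM2l// ltf_pV2 ?posrE ?ltr0n// ltr_nat.
- by rewrite gtrBl divr_gt0.
exists (Num.bound ((x - a) / (x - r))%R).
have e0 : (0 < x - r)%R by rewrite subr_gt0.
rewrite ltrBrDl -ltrBrDr ltr_pdivrMr// mulrC -ltr_pdivrMr//.
apply: (@lt_trans _ _ ((Num.bound ((x - a) / (x - r))%R)%:R)%R).
  by apply: archi_boundP; rewrite divr_ge0// ltW.
by rewrite ltr_nat.
Qed.

(** Induction on the target height. At a successor a rational of the right colour is put on top; at
    a limit the suprema of a chain climbing the ladder converge to such a rational. *)
Lemma utree_extend C f : ladder_system C ->
  forall c s a b n, utree C f s -> ubound (sigmaQ_set s) a -> a < b -> ht s < c ->
  exists t, [/\ utree C f t, ht t = c, sup_colour t = n & ext s a b t].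
Proof.
move=> lC; elim/omega1_ind => c IH s a b n Ts ub ab sc.
have [lc|nlc] := pselect (is_limit c); last first.
  have [c' c'c c'max] : exists2 c', c' < c & forall d, d < c -> d <= c'.
    apply: contrapT => H; apply: nlc; split; first by exists (ht s).
    move=> d dc; apply: contrapT => H2; apply: H; exists d => // e ec.
    by rewrite leNgt; apply/negP => de; apply: H2; exists e.
  (* The points needed to reach [c'] stay below [m], leaving room above [m] for the last one, which
     becomes the supremum. *)
  have [am mb] := midf_lt ab; set m := ((a + b) / 2)%R in am mb.
  have [t0 [Tt0 ht0 e0]] : exists t0, [/\ utree C f t0, ht t0 = c' & ext s a m t0].
    have := c'max _ sc; rewrite le_eqVlt => /orP[/eqP E|sc'].
      by exists s; split=> //; exact: ext_refl.
    by have [t0 [? ? _ ?]] := IH c' c'c s a m 0%N Ts ub am sc'; exists t0.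
  have [r [mr rb rn]] := rat_colour_dense n mb.
  have ub0 := ext_ubound ub am e0.
  have [|t [tE t0t tpred]] := @add_point t0 r.
    by move=> y /ub0 ym; exact: le_lt_trans ym mr.
  have htt : ht t = c.
    apply: ht_eq => [u /tpred/ht_le|d /c'max dc'].
      by rewrite ht0 => uc'; exact: le_lt_trans uc' c'c.
    by exists t0; rewrite ?ht0.
  exists t; split=> //.
  - move=> u; rewrite le_eqVlt => /orP[/eqP->|/tpred ut0]; last exact: Tt0.
    by rewrite htt.
  - rewrite (@sup_colour_lub t r)//; split; rewrite tE.
      by move=> y [/ub0 ym|->//]; exact: le_trans ym (ltW mr).
    by move=> q; apply; right.
  - apply: ext_trans (ext_sub (lexx _) (ltW mb) e0) _; split; first exact: ltW.
    by move=> y; rewrite tE => -[//|->] _; rewrite rb andbT (lt_trans am).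
have [x [ax xb xn]] := rat_colour_dense n ab.
have [q [q0 qinc qx qcof]] := rat_approx ax.
have [g [gC gS gm gcof]] := ladder_enum lC lc.
(* Heights stay below [c], so the induction hypothesis gives the closure that [ladder_step] asks
   for. *)
pose M := [set s | utree C f s /\ ht s < c].
have Mext s' p r y k : M s' -> ubound (sigmaQ_set s') p -> p < r -> ht s' < y ->
    y < c -> exists t, [/\ M t, ht t = y, sup_colour t = k & ext s' p r t].
  move=> [Ts' _] ub' pr s'y yc.
  have [t [? htt ? ?]] := IH y yc s' p r k Ts' ub' pr s'y.
  by exists t; split=> //; split=> //; rewrite htt.
have step := ladder_step f gS gm Mext.
have [||u [u0 uP uR]] := @dependent_choice_nat sigmaQ
  (fun k s' => M s' /\ ubound (sigmaQ_set s') (q k))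
  (fun k s' t => [/\ ext s' (q k) (q k.+1) t, g k <= ht t
    & forall x, C c x -> ht s' < x -> x <= ht t -> sup_colour (restr t x) = f c x]) s.
- by rewrite q0.
- move=> k s' [Ms' ub'].
  (* Stage [k] must pass [g k] itself, and [ladder_step] treats indices below its argument, hence
     [k.+1]. *)
  have [t [Mt et gt ft]] := step k.+1 s' _ _ (fun i _ => (gC i).2) Ms' ub' (qinc k).
  exists t; split; last by split=> //; exact: gt.
  by split=> //; exact: ext_ubound ub' (qinc k) et.
have ue k : ext (u k) (q k) x (u k.+1).
  by have [e _ _] := uR k; exact: ext_sub (lexx _) (ltW (qx _)) e.
have [||||v vu ev] := @ext_union u q (fun=> x) _ _ _ _ ue.
- by have [] := uP 0%N.
- exact: qx.
- by move=> k; exact: ltW.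
- by [].
have [|||||||hv Tv ltv] := @utree_limit C f c u v lC lc.
- by move=> k; have [[]] := uP k.
- by move=> k; have [] := ue k.
- by move=> k; have [] := ev k.
- exact: vu.
- by move=> k; have [[]] := uP k.
- by move=> d /gcof[k dk]; exists k.+1; have [_ gk _] := uR k; exact: le_trans (ltW dk) gk.
- by move=> k y Cy; have [_ _] := uR k; apply.
exists v; split=> //; last first.
  by rewrite -u0 -q0; apply: ext_sub (lexx _) (ltW xb) (ev 0%N).
rewrite (@sup_colour_lub v x)//; split.
  by apply: (@ext_ubound (u 0%N) _ (q 0%N)) => //; have [] := uP 0%N.
(* Suppose [r < x] bounds [v] and [r < q k]. As [u k < v], some point of [v] is new after stage [k]
   and so exceeds [q k]. *)
move=> r vr; rewrite leNgt; apply/negP => /qcof[k rk].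
have /sigmaQ_ltP[y vy E] := ltv k.
have /(ev k).2 : sigmaQ_set v y by [].
rewrite E => /(_ _)/andP[|qy _]; first by case; rewrite ltxx.
by have := vr _ vy; rewrite leNgt (lt_trans rk qy).
Qed.

(** * Countable closed families of nodes, and non-speciality *)

(** Iterate countably often: each step adds values of [F] and raises the bound above all heights so
    far. A parameter below the final bound is below some intermediate one, and the next step
    contains the value there. *)
Lemma countable_closure (I : countType) (F : sigmaQ -> omega1 -> I -> sigmaQ)
    (M0 : set sigmaQ) (d0 : omega1) : countable M0 ->
  exists (M : set sigmaQ) (d : omega1),
    [/\ countable M, M0 `<=` M, d0 < d, forall s, M s -> ht s < d
      & forall s x i, M s -> x < d -> M (F s x i)].
Proof.
move=> cM0.
pose new (M : set sigmaQ) (d : omega1) : set sigmaQ :=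
  \bigcup_(s in M) \bigcup_(x in [set x | x < d]) range (F s x).
pose up (M : set sigmaQ) (d : omega1) : set omega1 := (ht @` M `|` [set d])%classic.
have [||u [u0 uP uR]] := @dependent_choice_nat (set sigmaQ * omega1)
  (fun _ Md => countable Md.1)
  (fun _ Md Nd => Nd.1 = (Md.1 `|` new Md.1 Md.2)%classic /\ Nd.2 = ssup (up Nd.1 Md.2))
  (M0, d0).
- exact: cM0.
- move=> _ [M d] /= cM; pose N := (M `|` new M d)%classic.
  exists (N, ssup (up N d)); split=> //; apply: countableU2 => //.
  apply: bigcup_countable => // s _; apply: bigcup_countable => [|x _].
    exact: omega1_countable.
  exact/countable_imageS.
have cup n : countable (up (u n.+1).1 (u n).2).
  by apply: countableU2 => //; apply: countable_imageS; exact: uP.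
have cd : countable (range (fun n => (u n).2)) by exact/countable_imageS.
have Mmon n m : (n <= m)%N -> (u n).1 `<=` (u m).1.
  move=> /subnKC <-; elim: (m - n)%N => [|k IH]; first by rewrite addn0.
  by rewrite addnS => s /IH us; have [-> _] := uR (n + k)%N; left.
have dlt n : (u n).2 < (u n.+1).2.
  by have [_ E] := uR n; rewrite E; apply: ssup_gt => //; right.
have dmon n m : (n <= m)%N -> (u n).2 <= (u m).2.
  move=> /subnKC <-; elim: (m - n)%N => [|k IH]; first by rewrite addn0.
  by rewrite addnS (le_trans IH)// ltW.
exists (\bigcup_n (u n).1), (ssup (range (fun n => (u n).2))); split.
- by apply: bigcup_countable => // n _; exact: uP.
- by move=> s M0s; exists 0%N => //; rewrite u0.
- by apply: ssup_gt => //; exists 0%N => //; rewrite u0.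
- move=> s [n _ us]; apply: (@lt_trans _ _ (u n.+1).2); last first.
    by apply: ssup_gt => //; exists n.+1.
  have [_ ->] := uR n; apply: ssup_gt => //; left; exists s => //.
  exact: Mmon (leqnSn n) _ us.
move=> s x i [n _ us] /lt_ssup[//|_ [m _ <-] xm].
(* Only [x <=] the [m]-th bound is known, so stage [m.+1] is the first one sure to admit [x]. *)
pose k := maxn n m.+1; have [E _] := uR k; exists k.+1 => //; rewrite E; right.
exists s; first exact: Mmon (leq_maxl _ _) _ us.
exists x; last by exists i.
apply: le_lt_trans xm _; apply: lt_le_trans (dlt m) _.
exact/dmon/leq_maxr.
Qed.

Lemma utree_root C f : exists s, utree C f s /\ ubound (sigmaQ_set s) 0%R.
Proof.
have w : wo_chain <=%O (mem (set0 : set rat)).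
  by apply: wo_chain_rat => B Bs [y /Bs].
have ub : ubound (set0 : set rat) 0%R by [].
exists (SigmaQ w (ex_intro _ 0%R ub)); split=> // t t0 [[b /ht_lt_ex[v vt _]] _].
by have /sigmaQ_ltP[x []] := lt_le_trans vt t0.
Qed.

(** The limit node [v] avoids [A n] for one of two reasons: stage [n] put a proper predecessor of
    [v] into this antichain, or it confined all later points to an interval in which no member of
    [A n] extends the current node. *)
Lemma utree_not_special C f : ladder_system C -> ~ special (utree C f).
Proof.
move=> lC [A Aac TE].
have AT n s : A n s -> utree C f s by move=> As; rewrite TE; exists n.
pose E1 s x (i : rat * rat * nat) := [set t | utree C f t /\
  [/\ ht t = x, sup_colour t = i.2 & ext s i.1.1 i.1.2 t]].
pose E2 s (i : rat * rat * nat) := [set t | A i.2 t /\ ext s i.1.1 i.1.2 t].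
(* The boolean selects one of the two closure properties; when nothing qualifies, the default [s]
   adds no new node. *)
pose F s x (i : bool * (rat * rat * nat)) :=
  if i.1 then xget s (E1 s x i.2) else xget s (E2 s i.2).
have [r [Tr ubr]] := utree_root C f.
pose closed (Md : set sigmaQ * omega1) :=
  (forall s, Md.1 s -> ht s < Md.2) /\
  forall s x i, Md.1 s -> x < Md.2 -> Md.1 (F s x i).
have close M d : countable M -> exists Md : set sigmaQ * omega1,
    [/\ countable Md.1, closed Md, M `<=` Md.1 & d < Md.2].
  move=> cM; have [M' [d' [cM' MM' dd' hM' FM']]] := countable_closure F d cM.
  by exists (M', d').
have [Md0 [cM0 clM0 M0r _]] := close [set r] (ht r) (countable1 r).
have [||u [u0 uP uR]] := @dependent_choice_nat (set sigmaQ * omega1)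
  (fun _ Md => countable Md.1 /\ closed Md)
  (fun _ Md Nd => Md.1 `<=` Nd.1 /\ Md.2 < Nd.2) Md0.
- by [].
- by move=> _ [M d] [/= cM _]; have [Nd []] := close M d cM; exists Nd.
pose M n := ((u n).1 `&` utree C f)%classic; pose d n := (u n).2.
have Mmon n s : M n s -> M n.+1 s.
  by move=> [us Ts]; split=> //; have [+ _] := uR n; exact.
have Mht n s : M n s -> ht s < d n by move=> [us _]; have [_ [+ _]] := uP n; exact.
have Mext n s p q x k : M n s -> ubound (sigmaQ_set s) p -> p < q -> ht s < x ->
    x < d n -> exists t, [/\ M n t, ht t = x, sup_colour t = k & ext s p q t].
  move=> [us Ts] ub pq sx xd.
  have [t [Tt ht_t ct et]] := utree_extend lC k Ts ub pq sx.
  have := @xgetI _ s (E1 s x (p, q, k)) t; case=> // Tz [hz cz ez].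
  exists (xget s (E1 s x (p, q, k))); split=> //; split=> //.
  by have [_ [_ cl]] := uP n; exact: (cl s x (true, (p, q, k))).
have Manti n s p q k : M n s -> (exists2 t, A k t & ext s p q t) ->
    exists t, [/\ M n t, A k t & ext s p q t].
  move=> [us Ts] [t At et].
  have := @xgetI _ s (E2 s (p, q, k)) t; case=> // Az ez.
  exists (xget s (E2 s (p, q, k))); split=> //; split; last exact: AT Az.
  (* [ht s] is a convenient height below [d n] at which to apply the closure. *)
  have [_ [hs cl]] := uP n; exact: (cl s (ht s) (false, (p, q, k))) us (hs _ us).
have cd : countable (range d) by exact/countable_imageS.
pose a := ssup (range d).
have dlt n : d n < d n.+1 by have [] := uR n.
have da n : d n < a by apply: ssup_gt => //; exists n.
have la : is_limit a.
  split; first by exists (d 0%N); exact: da.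
  move=> b /lt_ssup[//|_ [n _ <-] bn]; exists (d n.+1) => //.
  exact: le_lt_trans bn (dlt n).
have [g [gC gS gm gcof]] := ladder_enum lC la.
(* A state is a node with the interval reserved for all later points. *)
pose P n (z : sigmaQ * (rat * rat)) :=
  [/\ M n z.1, ubound (sigmaQ_set z.1) z.2.1 & z.2.1 < z.2.2].
pose R n (z w : sigmaQ * (rat * rat)) :=
  [/\ ext z.1 z.2.1 z.2.2 w.1, z.2.1 <= w.2.1 /\ w.2.2 <= z.2.2,
      forall x, C a x -> ht z.1 < x -> x <= ht w.1 -> sup_colour (restr w.1 x) = f a x,
      forall x, C a x -> x < d n -> x <= ht w.1
    & A n w.1 \/ forall t, A n t -> ~ ext w.1 w.2.1 w.2.2 t].
have step n z : P n z -> exists w, P n.+1 w /\ R n z w.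
  case: z => s [p q] [/= Ms ub pq].
  (* Points below [m1] climb the ladder, those between [m1] and [m2] try to enter [A n]. After
     success the reserve is [(m2, q)]; after failure it is [(m1, m2)], so that the failure covers
     every later extension. *)
  have [p1 p1q] := midf_lt pq; set m1 := ((p + q) / 2)%R in p1 p1q.
  have [m12 m2q] := midf_lt p1q; set m2 := ((m1 + q) / 2)%R in m12 m2q.
  (* [k] counts the ladder points below [d n], finitely many because [d n < a]. *)
  have [k [kd dk]] : exists k, (forall i, (i < k)%N -> g i < d n) /\ d n <= g k.
    have ex : exists k, d n <= g k by have [k /ltW] := gcof _ (da n); exists k.
    case: (ex_minnP ex) => k dk kmin; exists k; split=> // i ik.
    by rewrite ltNge; apply/negP => /kmin; rewrite leqNgt ik.
  have [t [Mt et gt ft]] := ladder_step f gS gm (Mext n) kd Ms ub p1.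
  have ubt := ext_ubound ub p1 et.
  have all_pts x : C a x -> x < d n -> x <= ht t.
    move=> /gS[i ->] gid; apply: gt.
    by rewrite -gm; exact: lt_le_trans gid dk.
  have [/(Manti n t _ _ _ Mt)[v [Mv Av ev]]|none] :=
      pselect (exists2 v, A n v & ext t m1 m2 v).
    have tv : t <= v by case: ev.
    exists (v, (m2, q)); split.
      by split=> //=; [exact: Mmon|exact: ext_ubound ubt m12 ev].
    split=> //=.
    - apply: ext_trans (ext_sub (lexx _) (ltW p1q) et) _.
      exact: ext_sub (ltW p1) (ltW m2q) ev.
    - by split=> //; rewrite ltW// (lt_trans p1).
    - move=> x Cx sx xv.
      (* As [v] is in [M n], its height is below [d n], where [t] has already passed every ladder
         point. *)
      have xt : x <= ht t by apply: all_pts Cx _; exact: le_lt_trans xv (Mht _ _ Mv).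
      by rewrite (restr_le tv xt) ft.
    - by move=> x Cx xd; exact: le_trans (all_pts _ Cx xd) (ht_le tv).
    - by left.
  exists (t, (m1, m2)); split; first by split=> //=; exact: Mmon.
  split=> //=.
  - exact: ext_sub (lexx _) (ltW p1q) et.
  - by split; exact: ltW.
  - by right=> v Av ev; apply: none; exists v.
have [|z [z0 zP zR]] := @dependent_choice_nat _ P R (r, (0%R, 1%R)) _ step.
  by split=> //; split=> //; rewrite u0; exact: M0r.
pose s n := (z n).1; pose p n := (z n).2.1; pose q n := (z n).2.2.
have se n : ext (s n) (p n) (q n) (s n.+1) by have [] := zR n.
have [||||v vs ev] := @ext_union s p q _ _ _ _ se.
- by have [] := zP 0%N.
- by have [] := zP 0%N.
- by move=> n; have [_ []] := zR n.
- by move=> n; have [_ []] := zR n.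
have [|||||||hv Tv ltv] := @utree_limit C f a s v lC la.
- by move=> n; have [[]] := zP n.
- by move=> n; have [] := se n.
- by move=> n; have [] := ev n.
- exact: vs.
- by move=> n; have [Ms _ _] := zP n; exact: lt_trans (Mht _ _ Ms) (da n).
- move=> b /gcof[k bk]; have [Ck ka] := gC k.
  (* Here [g k <= d n < d n.+1], and stage [n.+1], whose result has index [n.+2], passes all ladder
     points below [d n.+1]. *)
  have [//|_ [n _ <-] kn] := lt_ssup _ ka; exists n.+2.
  have [_ _ _ pts _] := zR n.+1; apply: le_trans (ltW bk) (pts _ Ck _).
  exact: le_lt_trans kn (dlt n).
- by move=> n x; have [_ _ + _ _] := zR n; exact.
move: (Tv); rewrite TE => -[n _ Av].
have [_ _ _ _ [As|none]] := zR n; last exact: none _ Av (ev n.+1).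
have E := Aac n _ _ As Av (ltW (ltv n.+1)).
by have := ltv n.+1; rewrite /s E ltxx.
Qed.

Theorem mainTheorem11 :
  exists h : sigmaQ -> nat,
  forall (C : omega1 -> set omega1) (f : omega1 -> omega1 -> nat),
    ladder_system C ->
    exists T : set sigmaQ, ~ special T /\ uniformization C f T h.
Proof.
exists sup_colour => C f lC; exists (utree C f); split; first exact: utree_not_special.
split; last by move=> s a Ts la /has_heightP E; subst a; exact: Ts.
split=> [s t|s a Ts]; first exact: utree_le.
have [sa|as_] := ltP (ht s) a; last first.
  by exists s; split=> //; exists (ht s) => //; exact/has_heightP.
(* New points go into the unit interval above a bound of [s]; the requested colour [0] is
   arbitrary. *)
have [q ubq] := sigmaQ_bounded s.
have qq : q < (q + 1)%R by rewrite ltrDl.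
have [t [Tt htt _ [st _]]] := utree_extend lC 0%N Ts ubq qq sa.
by exists t; split=> //; exists a => //; exact/has_heightP.
Qed.
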